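(* Fix integers $n\ge 1$ and $0\le m\le N$, where $N=\binom{n}{2}$. For every integer $i\ge 1$, the square matrices $D_0, D_1, D_{i-1}, D_i, D_{i+1}$ (indexed by isomorphism classes of graphs with $n$ vertices and $m$ edges) satisfy \[ D_1D_i=(m-i+1)(N-m-i+1)D_{i-1} + i(N-2i)D_i + (i+1)^2D_{i+1}. \]
   Context: All graphs are simple (no loops, no multiple edges). For a graph $G$ on a fixed set of $n$ vertices with $m$ edges, $G^c$ denotes its complement and $N=\binom{n}{2}$. For an integer $j\ge 0$, the perturbed $j$-deck $PD_j(G)$ is the multiset of graphs $G-X+Y$, where $X$ ranges over all $j$-subsets of $E(G)$ and $Y$ ranges over all $j$-subsets of $E(G^c)$ (so the removed and added edge sets are disjoint); every such graph again has $n$ vertices and $m$ edges. Let $G_1,G_2,\dots$ be representatives of the isomorphism classes of graphs with $n$ vertices and $m$ edges. $D_j$ is the square matrix whose $(k,l)$ entry is the number of members of $PD_j(G_l)$ isomorphic to $G_k$ (this is the zero matrix if $j>\min(m,N-m)$); in particular $D_0$ is the identity matrix. Products are ordinary matrix products. *)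

(* Defs.v *)
From HB Require Import structures.
From mathcomp Require Import all_boot all_order all_fingroup all_algebra.

Set Implicit Arguments.
Unset Strict Implicit.
Unset Printing Implicit Defensive.

Local Open Scope ring_scope.

Definition edge (n : nat) : finType := {e : {set 'I_n} | #|e| == 2%N}.

(* A simple graph on the vertex set 'I_n is given by its edge set: #|G| is the
   number of edges of G, and ~: G is its complement graph. *)
Definition graph (n : nat) : finType := {set edge n}.

Definition adj n (G : graph n) (x y : 'I_n) : bool :=
  [exists e in G, val e == [set x; y]].

Definition isomorphic n (G H : graph n) : bool :=
  [exists p : 'S_n, [forall x, [forall y, adj H (p x) (p y) == adj G x y]]].

Definition jsubsets n (j : nat) (G : graph n) : {set graph n} :=
  [set X : graph n | (X \subset G) && (#|X| == j)].

(* A multiset of graphs is represented by a sequence: the graphs G - X + Y are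
   listed with multiplicity, one for each pair (X, Y). *)
Definition perturbed_deck n (j : nat) (G : graph n) : seq (graph n) :=
  [seq (G :\: X) :|: Y | X <- enum (jsubsets j G), Y <- enum (jsubsets j (~: G))].

Definition iso_representatives n (m s : nat) (r : 'I_s -> graph n) : Prop :=
  [/\ forall k, #|r k| = m,
      forall k l, isomorphic (r k) (r l) -> k = l
    & forall G : graph n, #|G| = m -> exists k, isomorphic G (r k)].

(* Integer entries, because the coefficients m - i + 1, N - m - i + 1 and
   N - 2i of the recurrence may be negative. *)
Definition Dmx n s (r : 'I_s -> graph n) (j : nat) : 'M[int]_s :=
  \matrix_(k, l)
    (count (fun H : graph n => isomorphic H (r k)) (perturbed_deck j (r l)))%:Z.

(* Main.v *)
(* With representatives replaced by actual edge sets, the deck of order [j] of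
   [G] lists exactly once each [H] with [#|H| = #|G|] and [#|G :\: H| = j].
   Hence [D_j] is the quotient, by the action of the vertex permutations, of the
   distance-[j] matrix of the Johnson graph on the [m]-subsets of the [N]
   possible edges, and the recurrence is the three-term relation of the Johnson
   scheme: moving from [K] to [b |: (K :\ a)] changes the distance to [G] by
   [(a \in G) - (b \in G)]. *)
Require Import Defs.
From HB Require Import structures.
From mathcomp Require Import all_boot all_order all_fingroup all_algebra.
From mathcomp Require Import zify ring.

Set Implicit Arguments.
Unset Strict Implicit.
Unset Printing Implicit Defensive.

Import GRing.Theory.

Local Open Scope ring_scope.

(** * Exchanges and distances among the subsets of a finite type *)

Section Johnson.

Variable T : finType.
Implicit Types (G H K X Y : {set T}) (a b : T).

Definition johnson (j : nat) G H := (#|H| == #|G|) && (#|G :\: H| == j).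

(** The exchange can be undone: [H] determines [X] and [Y]. Both injectivity arguments below rest on
    this. *)
Lemma setDU_exchange G X Y : X \subset G -> Y \subset ~: G ->
  let H := (G :\: X) :|: Y in G :\: H = X /\ H :\: G = Y.
Proof.
move=> /subsetP sXG /subsetP sYG /=; split; apply/setP => x;
  move: (sXG x) (sYG x); rewrite !inE;
  by case: (x \in X); case: (x \in Y); case: (x \in G) => // h1 h2;
    move: (h1 isT) || move: (h2 isT).
Qed.

Lemma card_setD_sym G H : #|H| = #|G| -> #|H :\: G| = #|G :\: H|.
Proof. by move=> eHG; rewrite !cardsD setIC eHG. Qed.

Lemma johnson_sym j G H : johnson j G H = johnson j H G.
Proof.
rewrite /johnson eq_sym; case: eqP => //= eGH.
by rewrite (card_setD_sym eGH).
Qed.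

Lemma johnson_exchange j G X Y :
  X \subset G -> Y \subset ~: G -> #|X| = j -> #|Y| = j ->
  johnson j G ((G :\: X) :|: Y).
Proof.
move=> sXG sYG cX cY; have [eX eY] := setDU_exchange sXG sYG.
rewrite /johnson eX cX eqxx andbT.
have := cardsID G ((G :\: X) :|: Y); have := cardsID ((G :\: X) :|: Y) G.
by rewrite eX eY setIC cX cY => <- <-.
Qed.

(** Used twice, for the removed and for the added element, to collapse a double sum over exchanges
    into four terms. *)
Lemma sum_mem_split (A G : {set T}) (F : bool -> int) :
  \sum_(a in A) F (a \in G)
  = #|A :&: G|%:Z * F true + #|A :\: G|%:Z * F false.
Proof.
rewrite (big_setID G) /=; congr (_ + _).
- rewrite (eq_bigr (fun=> F true)); last by move=> a /setIP[_ ->].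
  by rewrite sumr_const -mulr_natl natz.
- rewrite (eq_bigr (fun=> F false)); last by move=> a /setDP[_ /negPf->].
  by rewrite sumr_const -mulr_natl natz.
Qed.

(** Dropping [a] from [K] adds it to the difference if it lies in [G]; adding [b] removes it
    likewise. The additive form avoids truncated subtraction. *)
Lemma card_setD_exchange1 G K a b : a \in K -> b \notin K ->
  (#|G :\: (b |: (K :\ a))| + (b \in G) = #|G :\: K| + (a \in G))%N.
Proof.
move=> aK bK; have nab : a != b by apply: contraNneq bK => <-.
rewrite (cardsD1 a (G :\: (b |: _))) (cardsD1 b (G :\: K)).
rewrite !inE !eqxx aK bK (negPf nab) /=.
have -> : (G :\: (b |: K :\ a)) :\ a = (G :\: K) :\ b.
  apply/setP => x; rewrite !inE.
  case: (eqVneq x a) => [->|]; first by rewrite aK !andbF.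
  by case: (eqVneq x b) => [->|]; rewrite ?andbF.
lia.
Qed.

(** A neighbour [H] of [K] comes from exactly one pair: [a] is the only element of [K :\: H] and [b]
    the only one of [H :\: K]. *)
Lemma sum_johnson1 K (F : {set T} -> int) :
  \sum_(H | johnson 1 K H) F H
  = \sum_(a in K) \sum_(b in ~: K) F (b |: (K :\ a)).
Proof.
rewrite pair_big /=.
pose f (u : T * T) := u.2 |: (K :\ u.1).
have fE u : u.1 \in K -> u.2 \in ~: K ->
    K :\: f u = [set u.1] /\ f u :\: K = [set u.2].
  rewrite -2!sub1set => uK uCK.
  by have := setDU_exchange uK uCK; rewrite /= setUC.
rewrite (eq_bigl (mem (f @: setX K (~: K)))) => [|H].
  rewrite big_imset /= => [|[a b] [c d]].
    by apply: eq_bigl => -[a b]; rewrite !inE.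
  rewrite !in_setX => /andP[/= aK bK] /andP[/= cK dK] eqf.
  have [] := fE (a, b) aK bK; have [] := fE (c, d) cK dK.
  by rewrite eqf /= => -> -> /set1_inj -> /set1_inj ->.
apply/idP/imsetP => [/andP[/eqP cH /cards1P[a eKH]]|[[a b]]].
  have /cards1P[b eHK] : #|H :\: K| == 1%N.
    by rewrite (card_setD_sym cH) eKH cards1.
  have aKH : a \in K :\: H by rewrite eKH set11.
  have bHK : b \in H :\: K by rewrite eHK set11.
  exists (a, b).
    by move: aKH bHK; rewrite !inE => /andP[_ ->] /andP[-> _].
  rewrite /f /= -eHK -eKH; apply/setP => x; rewrite !inE.
  by case: (x \in H); case: (x \in K).
rewrite in_setX => /andP[/= aK bK] ->.
rewrite /f setUC; apply: johnson_exchange; rewrite ?cards1 ?sub1set //.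
Qed.

(** With m = #|G|, N = #|T| and j = #|G :\: K|, exactly (m-j)(N-m-j) exchanges raise the distance to
    [G], j^2 lower it, and (m-j)j + j(N-m-j) = j(N-2j) keep it. Setting j to i-1, i+1 and i gives
    the coefficients. *)
Lemma johnson_recurrence (i : nat) G K : (0 < i)%N -> #|K| = #|G| ->
  \sum_(H | johnson 1 K H) (johnson i G H)%:Z
  = (#|G|%:Z - i%:Z + 1) * (#|T|%:Z - #|G|%:Z - i%:Z + 1)
      * (johnson (i - 1) G K)%:Z
    + i%:Z * (#|T|%:Z - 2 * i%:Z) * (johnson i G K)%:Z
    + (i%:Z + 1) ^+ 2 * (johnson (i + 1) G K)%:Z :> int.
Proof.
move=> i_gt0 cKG; rewrite sum_johnson1.
set j := #|G :\: K|.
(* Indicator that the exchange ends at distance [i], where [u] and [v] tell whether the removed and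
   the added element lie in [G]. *)
pose F (u v : bool) : int := (j + u == i + v)%N%:Z.
have -> : \sum_(a in K) \sum_(b in ~: K) (johnson i G (b |: (K :\ a)))%:Z
    = \sum_(a in K) \sum_(b in ~: K) F (a \in G) (b \in G).
  apply: eq_bigr => a aK; apply: eq_bigr => b; rewrite inE => bK.
  rewrite /johnson /F /j -(card_setD_exchange1 G aK bK) eqn_add2r.
  have -> // : #|b |: K :\ a| == #|G|.
  by rewrite cardsU1 !inE (negPf bK) andbF -cKG (cardsD1 a K) aK.
under eq_bigr => a _ do rewrite (sum_mem_split _ _ (F (a \in G))).
pose F' u := #|~: K :&: G|%:Z * F u true + #|~: K :\: G|%:Z * F u false.
rewrite (sum_mem_split _ _ F') /F' {F'}.
have cGK : #|K :\: G| = j by apply: card_setD_sym.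
have cI : (#|K :&: G| + j = #|G|)%N by rewrite -cGK -cKG cardsID.
have -> : ~: K :&: G = G :\: K by rewrite setIC -setDE.
have cO : (#|~: K :\: G| + j + #|G| = #|T|)%N.
  rewrite -[RHS](cardsC K) -cKG addnC; congr (_ + _)%N.
  by rewrite -(cardsID G (~: K)) addnC setIC -setDE.
rewrite cGK -/j /johnson cKG eqxx -/j /F /=.
case: i i_gt0 @F => // i _.
rewrite subn1 !addn1 !addn0 !eqSS -cO -cI !PoszD /=.
(* Here [i] is the predecessor of the original index, so the three values are the original i-1, i
   and i+1; for any other [j] both sides vanish. *)
have [->|n1] := eqVneq j i; last have [->|n2] := eqVneq j i.+1;
  last have [->|n3] := eqVneq j i.+2.
all: rewrite ?[i == _]ltn_eqF ?[i.+1 == _]ltn_eqF // !intS /=; ring.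
Qed.

End Johnson.

(** * Vertex permutations acting on graphs, and decks up to isomorphism *)

Section Isomorphism.

Variable n : nat.
Implicit Types (G H K : graph n) (p q : 'S_n) (e : edge n).

Lemma edge_act_subproof p e : #|p @: val e| == 2%N.
Proof. by rewrite card_imset ?(valP e) //; apply: perm_inj. Qed.

Definition edge_act p e : edge n := Sub (p @: val e) (edge_act_subproof p e).

Lemma edge_actK p : cancel (edge_act p) (edge_act p^-1%g).
Proof.
move=> e; apply: val_inj; rewrite /= -imset_comp (eq_imset _ (permK p)).
exact: imset_id.
Qed.

Lemma edge_actM p q e : edge_act (p * q)%g e = edge_act q (edge_act p e).
Proof.
by apply: val_inj; rewrite /= -imset_comp; apply: eq_imset => x; rewrite /= permM.
Qed.

Lemma edge_act_inj p : injective (edge_act p).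
Proof. exact: can_inj (edge_actK p). Qed.

Lemma edge_act_imsetK p : cancel (fun G => edge_act p @: G)
                                 (fun G => edge_act p^-1%g @: G).
Proof.
by move=> G; rewrite -imset_comp (eq_imset _ (edge_actK p)) imset_id.
Qed.

Lemma adj_edge G e (x y : 'I_n) : val e = [set x; y] -> adj G x y = (e \in G).
Proof.
move=> eE; apply/existsP/idP => [[e' /andP[e'G /eqP e'E]]|eG].
  by have -> : e = e' by apply: val_inj; rewrite e'E.
by exists e; rewrite eG eE /=.
Qed.

Lemma isomorphicP G H :
  reflect (exists p, H = edge_act p @: G) (isomorphic G H).
Proof.
apply: (iffP existsP) => -[p].
  move=> /forallP pP; exists p; apply/setP => e.
  rewrite -[e](edge_actK p^-1%g) invgK (mem_imset _ _ (@edge_act_inj p)).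
  set e' := edge_act _ e.
  have /cards2P[x [y [_ eE]]] := valP e'.
  rewrite -(adj_edge _ eE) -(eqP (forallP (pP x) y)); apply/esym/adj_edge.
  by rewrite -[LHS]/(p @: val e') eE imsetU1 imset_set1.
move=> ->; exists p; apply/forallP => x; apply/forallP => y; apply/eqP.
have [c2|c2] := boolP (#|[set x; y]| == 2%N).
  pose e : edge n := Sub [set x; y] c2.
  rewrite (@adj_edge G e) // (@adj_edge _ (edge_act p e)).
    by rewrite mem_imset //; apply: edge_act_inj.
  by rewrite /= imsetU1 imset_set1.
(* Remaining case [x = y]: a singleton is no edge, so both adjacencies fail. *)
have adj0 K z t : #|[set z; t]| != 2%N -> adj K z t = false.
  move=> c; apply/existsP => -[e /andP[_ /eqP eE]].
  by move: c; rewrite -eE (valP e).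
rewrite !adj0 // (_ : [set p x; p y] = p @: [set x; y]).
  by rewrite card_imset //; apply: perm_inj.
by rewrite imsetU1 imset_set1.
Qed.

Lemma isomorphic_sym G H : isomorphic G H -> isomorphic H G.
Proof.
by move=> /isomorphicP[p ->]; apply/isomorphicP; exists p^-1%g;
  rewrite edge_act_imsetK.
Qed.

Lemma isomorphic_trans G H K :
  isomorphic G H -> isomorphic H K -> isomorphic G K.
Proof.
move=> /isomorphicP[p ->] /isomorphicP[q ->]; apply/isomorphicP.
exists (p * q)%g; rewrite -imset_comp.
by apply: eq_imset => e; rewrite /= edge_actM.
Qed.

Lemma johnson_edge_act j p G H :
  johnson j (edge_act p @: G) (edge_act p @: H) = johnson j G H.
Proof.
have cI K : #|edge_act p @: K| = #|K| by rewrite card_imset //; apply: edge_act_inj.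
rewrite /johnson !cI !cardsD -imsetI ?cI //.
by move=> x y _ _; apply: edge_act_inj.
Qed.

(** As a list of labelled graphs the deck has no repetition, since [X] and [Y] are recovered from
    [H] as [G :\: H] and [H :\: G]. *)
Lemma count_perturbed_deck j G (P : pred (graph n)) :
  (count P (perturbed_deck j G))%:Z
  = \sum_(H | P H) (johnson j G H)%:Z :> int.
Proof.
have uD : uniq (perturbed_deck j G).
  apply: allpairs_uniq; rewrite ?enum_uniq // => -[X Y] [X' Y'].
  move=> /allpairsP[[X1 Y1] /= [hX hY [-> ->]]].
  move=> /allpairsP[[X2 Y2] /= [hX' hY' [-> ->]]] /= eqH.
  move: hX hY hX' hY'; rewrite !mem_enum !inE.
  move=> /andP[sX _] /andP[sY _] /andP[sX' _] /andP[sY' _].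
  have [] := setDU_exchange sX sY; have [] := setDU_exchange sX' sY'.
  by rewrite eqH => -> -> -> ->.
have memD H : (H \in perturbed_deck j G) = johnson j G H.
  apply/allpairsP/idP => [[[X Y] /= []]|/andP[/eqP cH /eqP cGH]].
    rewrite !mem_enum !inE => /andP[sX /eqP cX] /andP[sY /eqP cY] ->.
    exact: johnson_exchange.
  exists (G :\: H, H :\: G); rewrite !mem_enum !inE /= subsetDl cGH eqxx.
  rewrite (card_setD_sym cH) cGH eqxx setDE subsetIr; split=> //.
  by apply/setP => x; rewrite !inE; case: (x \in G); case: (x \in H).
rewrite -size_filter -(card_uniqP (filter_uniq P uD)) -sum1_card.
rewrite -natz natr_sum big_mkcond [RHS]big_mkcond /=.
apply: eq_bigr => H _; rewrite mem_filter memD.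
by case: (P H); case: (johnson j G H).
Qed.

(** A vertex permutation preserves distances and permutes each isomorphism class, so a matrix entry
    may be computed from any graph in the class of its column. *)
Lemma sum_johnson_isomorphic j G H R : isomorphic G H ->
  \sum_(K | isomorphic K R) (johnson j H K)%:Z
  = \sum_(K | isomorphic K R) (johnson j G K)%:Z :> int.
Proof.
move=> /isomorphicP[p ->].
rewrite (reindex_inj (can_inj (edge_act_imsetK p))) /=.
apply: eq_big => [K|K _]; last by rewrite johnson_edge_act.
have KpK : isomorphic K (edge_act p @: K) by apply/isomorphicP; exists p.
by apply/idP/idP; apply: isomorphic_trans => //; apply: isomorphic_sym.
Qed.

Lemma card_edge : #|edge n| = 'C(n, 2).
Proof.
rewrite card_sig -[n in RHS]card_ord -card_draws cardsE.
by apply: eq_card => e; rewrite !inE.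
Qed.

End Isomorphism.

Theorem theorem2p2 (n m : nat) (hn : (1 <= n)%N) (hm : (m <= 'C(n, 2))%N)
    (s : nat) (r : 'I_s -> graph n) (hr : iso_representatives m r)
    (i : nat) (hi : (1 <= i)%N) :
  let N := 'C(n, 2) in
  Dmx r 1 *m Dmx r i =
    ((m%:Z - i%:Z + 1) * (N%:Z - m%:Z - i%:Z + 1)) *: Dmx r (i - 1)%N
    + (i%:Z * (N%:Z - 2 * i%:Z)) *: Dmx r i
    + ((i%:Z + 1) ^+ 2) *: Dmx r (i + 1)%N.
Proof.
case: hr => cr r_inj r_surj /=; apply/matrixP => k l.
have DE j a b : Dmx r j a b = \sum_(H | isomorphic H (r a)) (johnson j (r b) H)%:Z.
  by rewrite mxE count_perturbed_deck.
rewrite !(DE, mxE).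
(* Both sides count pairs (K, H) with [K] in the class of [r k], [H] at distance 1 from [K] and at
   distance [i] from [r l]. *)
transitivity (\sum_(K | isomorphic K (r k)) \sum_(H | johnson 1 K H)
               (johnson i (r l) H)%:Z : int).
  under eq_bigr => p _ do rewrite (DE i) big_distrr /= big_mkcond /=.
  rewrite exchange_big /= [RHS](exchange_big_dep predT) //=.
  apply: eq_bigr => H _.
  have [jH|jH] := boolP (johnson i (r l) H); last first.
    by rewrite !big1 // => p _; rewrite mulr0 if_same.
  have /andP[/eqP cH _] := jH.
  have [p0 Hp0] := r_surj H (etrans cH (cr l)).
  (* Only the index [p0] of the class of [H] contributes, and its [Dmx r 1] entry can be computed
     from [H] in place of [r p0]. *)
  rewrite (bigD1 p0) //= Hp0 mulr1 big1 ?addr0 => [|p np].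
    rewrite DE (sum_johnson_isomorphic _ _ Hp0) big_mkcondr /=.
    by apply: eq_bigr => K _; rewrite johnson_sym; case: ifP.
  case: ifP => // Hp; case/eqP: np; apply: r_inj.
  exact: isomorphic_trans (isomorphic_sym Hp) Hp0.
(* The identity now holds term by term, for each labelled [K] isomorphic to [r k]. *)
rewrite !big_distrr -!big_split /=; apply: eq_bigr => K.
move=> /isomorphicP[p rkE].
have cK : #|K| = m.
  by rewrite -(cr k) rkE card_imset //; apply: edge_act_inj.
by rewrite johnson_recurrence ?cr // card_edge.
Qed.
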